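(* Let $\mathrm{U}$ be a countable homogeneous relational structure whose age has free amalgamation, with automorphism group $\mathrm{G}$, and let $\mathcal B=\{\underline B_j:j\in n\}$ ($n\in\omega$) be a bundle of types of $\mathrm{U}$. Then: (1) if $S\subseteq\sigma(\mathcal B)$ satisfies $\overline\rho(S)=\overline\rho(\sigma(\mathcal B))$, then for every $m\in\omega$ and every $m$-colouring $P$ of $S$ there is $\epsilon\in\mathcal E(P)$ with $\overline\rho(P_\epsilon\cap S)=\overline\rho(\sigma(\mathcal B))$; (2) every $S\subseteq\sigma(\mathcal B)$ with $\overline\rho(S)=\overline\rho(\sigma(\mathcal B))$ is $\mathcal B$-age indivisible; (3) the bundle $\mathcal B$ is $\mathcal B$-age indivisible; (4) every type $\underline T$ of $\mathrm{U}$ is age indivisible, i.e. for every partition $(S_0,S_1)$ of $\sigma(\underline T)$ there is $i\in 2$ such that for every finite $A\subseteq\sigma(\underline T)$ there is $f\in\mathrm{G}_{\iota(\underline T)}$ with $f[A]\subseteq S_i$.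
   Context: Relational languages have no $0$-ary symbols; relations hold on distinct entries only. Homogeneous: every isomorphism between finite induced substructures extends to an automorphism. Free amalgamation: the age is closed under induced substructures and free amalgams (union of two structures agreeing on a common part with no relation on a tuple meeting both non-common parts). $\mathrm{G}_F$ is the pointwise stabilizer. A type is $\langle F\mid x\rangle$, $F$ finite (the sockel $\iota$), $x\notin F$; typeset $\sigma(\langle F\mid x\rangle)=\{g(x):g\in\mathrm{G}_F\}$. A bundle is a set of distinct types $\underline B_j$ with common sockel $\iota(\mathcal B)$; $\sigma(\mathcal B)=\bigcup_j\sigma(\underline B_j)$. For $S\subseteq\sigma(\mathcal B)$, $\overline\rho(S)$ is the set of finite $A\subseteq\sigma(\mathcal B)$ with $g[A]\subseteq S$ for some $g\in\mathrm{G}_{\iota(\mathcal B)}$. A colouring of $S\subseteq\sigma(\mathcal B)$ is a family $P=(P_{i,j}:i\in m_j,\ j\in n)$ of pairwise disjoint sets with $\bigcup_{i\in m_j}P_{i,j}=S\cap\sigma(\underline B_j)$ for each $j$; it is an $m$-colouring if $\max_j m_j=m$. $\mathcal E(P)$ is the set of functions $\epsilon$ on $n$ with $\epsilon(j)\in m_j$, and $P_\epsilon=\bigcup_{j}P_{\epsilon(j),j}$. $S$ is $\mathcal B$-age indivisible if for every colouring $P$ of $S$ some $\epsilon\in\mathcal E(P)$ has $\overline\rho(P_\epsilon)=\overline\rho(S)$; $\mathcal B$ is $\mathcal B$-age indivisible if $\sigma(\mathcal B)$ is. *)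

(* Defs.v *)
From mathcomp Require Import all_boot.
From mathcomp Require Import all_classical.

Set Implicit Arguments.
Unset Strict Implicit.
Unset Printing Implicit Defensive.

Local Open Scope classical_set_scope.

Record language := Language {
  symbol : Type;
  arity : symbol -> nat;
  arity_gt0 : forall l, 0 < arity l }.

Record structure (L : language) (U : Type) := Structure {
  rel_of : forall l : symbol L, ('I_(arity l) -> U) -> Prop;
  rel_distinct : forall l t, rel_of (l := l) t -> injective t }.

Lemma induced_distinct (L : language) (U : Type) (M : structure L U)
    (A : set U) (l : symbol L) (t : 'I_(arity l) -> A) :
  rel_of M (fun i => \val (t i)) -> injective t.
Proof. by move=> /rel_distinct inj_t i j eq_ij; apply: inj_t; rewrite eq_ij. Qed.

Definition induced (L : language) (U : Type) (M : structure L U) (A : set U) :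
  structure L A := Structure (@induced_distinct L U M A).

Definition isomorphism (L : language) (V W : Type)
    (N : structure L V) (M : structure L W) (h : V -> W) : Prop :=
  bijective h /\
  forall (l : symbol L) (t : 'I_(arity l) -> V),
    rel_of N t <-> rel_of M (h \o t).

Definition Aut (L : language) (U : Type) (M : structure L U) : set (U -> U) :=
  [set g | isomorphism M M g].

Definition stabilizer (L : language) (U : Type) (M : structure L U)
    (F : set U) : set (U -> U) :=
  [set g | Aut M g /\ forall x, F x -> g x = x].

Definition homogeneous (L : language) (U : Type) (M : structure L U) : Prop :=
  forall (A B : set U) (h : A -> B), finite_set A -> finite_set B ->
    isomorphism (induced M A) (induced M B) h ->
    exists2 g, Aut M g & forall a : A, g (\val a) = \val (h a).

Definition structure_class (L : language) :=
  forall V : Type, structure L V -> Prop.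

Definition age (L : language) (U : Type) (M : structure L U) :
    structure_class L := fun V N =>
  finite_set [set: V] /\
  exists (A : set U) (h : V -> A), isomorphism N (induced M A) h.

Definition hereditary (L : language) (K : structure_class L) : Prop :=
  forall (V : Type) (N : structure L V) (A : set V),
    K V N -> K A (induced N A).

(* [C] is the free amalgam of its induced substructures on [X] and [Y]; their
   common part is the substructure induced on [X `&` Y]. *)
Definition is_free_amalgam (L : language) (W : Type) (C : structure L W)
    (X Y : set W) : Prop :=
  X `|` Y = setT /\
  forall (l : symbol L) (t : 'I_(arity l) -> W),
    (exists i, (X `\` Y) (t i)) -> (exists j, (Y `\` X) (t j)) -> ~ rel_of C t.

Definition free_amalgamation (L : language) (K : structure_class L) : Prop :=
  hereditary K /\
  forall (W : Type) (C : structure L W) (X Y : set W),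
    is_free_amalgam C X Y -> K X (induced C X) -> K Y (induced C Y) -> K W C.

Record vtype (U : Type) := VType {
  sockel : set U;
  point : U;
  sockel_finite : finite_set sockel;
  point_notin : ~ sockel point }.

Definition typeset (L : language) (U : Type) (M : structure L U)
    (T : vtype U) : set U :=
  [set g (point T) | g in stabilizer M (sockel T)].

(* The common sockel is a field because it cannot be read off the types when
   [n = 0].  Types are compared as pairs <F | x>, so two types of a bundle may
   have the same typeset. *)
Record bundle (U : Type) (n : nat) := Bundle {
  bsockel : set U;
  btype : 'I_n -> vtype U;
  bsockel_finite : finite_set bsockel;
  btype_sockel : forall j, sockel (btype j) = bsockel;
  btype_distinct : injective btype }.

Definition btypeset (L : language) (U : Type) (M : structure L U) (n : nat)
    (B : bundle U n) : set U :=
  \bigcup_j typeset M (btype B j).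

Definition rho_bar (L : language) (U : Type) (M : structure L U) (n : nat)
    (B : bundle U n) (S : set U) : set (set U) :=
  [set A | [/\ finite_set A, A `<=` btypeset M B &
     exists2 g, stabilizer M (bsockel B) g & g @` A `<=` S]].

Record colouring (L : language) (U : Type) (M : structure L U) (n : nat)
    (B : bundle U n) (S : set U) := Colouring {
  ncolours : 'I_n -> nat;
  part : forall j, 'I_(ncolours j) -> set U;
  part_disjoint :
    trivIset setT (fun ij : {j : 'I_n & 'I_(ncolours j)} =>
                     part (tagged ij));
  part_cover : forall j,
    \bigcup_i part (j := j) i = S `&` typeset M (btype B j) }.

Definition is_mcolouring (L : language) (U : Type) (M : structure L U)
    (n : nat) (B : bundle U n) (S : set U) (m : nat) (P : colouring M B S) :
    Prop :=
  \max_(j < n) ncolours P j = m.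

Definition selector (L : language) (U : Type) (M : structure L U) (n : nat)
    (B : bundle U n) (S : set U) (P : colouring M B S) : Type :=
  forall j : 'I_n, 'I_(ncolours P j).

Definition selection (L : language) (U : Type) (M : structure L U) (n : nat)
    (B : bundle U n) (S : set U) (P : colouring M B S) (e : selector P) :
    set U :=
  \bigcup_j part (e j).

Definition age_indivisible_in (L : language) (U : Type) (M : structure L U)
    (n : nat) (B : bundle U n) (S : set U) : Prop :=
  forall P : colouring M B S,
    exists e : selector P, rho_bar M B (selection e) = rho_bar M B S.

Definition bundle_age_indivisible (L : language) (U : Type)
    (M : structure L U) (n : nat) (B : bundle U n) : Prop :=
  age_indivisible_in M B (btypeset M B).

(* The parts of a partition are allowed to be empty. *)
Definition type_age_indivisible (L : language) (U : Type)
    (M : structure L U) (T : vtype U) : Prop :=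
  forall S : 'I_2 -> set U,
    trivIset setT S -> \bigcup_i S i = typeset M T ->
    exists i : 'I_2, forall A : set U, finite_set A -> A `<=` typeset M T ->
      exists2 f, stabilizer M (sockel T) f & f @` A `<=` S i.

(* Main.v *)
(* Write F for the sockel and G_F for its pointwise stabilizer; the typesets
   are orbits of G_F. As there are only finitely many selections, the union of
   one obstruction for each of them is still finite; so it suffices to find,
   for every finite A and every number of colours, a finite C such that each
   colouring of C admits g in G_F with g A contained in C and g A monochromatic
   on every orbit. The orbits are treated one after the other. For a single
   orbit this is a partite construction carried out inside U: start with many
   copies of A, freely independent over F, whose points in the orbit are
   distributed over parts that carry no relation across two of their points;
   make the parts monochromatic one at a time by freely amalgamating copies
   along a larger free part; then two applications of the pigeonhole principle,
   one inside each part and one on the parts, give a monochromatic copy. *)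
Require Import Defs.
From mathcomp Require Import all_boot.
From mathcomp Require Import all_classical.

Set Implicit Arguments.
Unset Strict Implicit.
Unset Printing Implicit Defensive.

Local Open Scope classical_set_scope.

(** * Finite sets as ranges and as types *)

Lemma finite_set_enum (T : Type) (A : set T) : finite_set A ->
  exists k (x : 'I_k -> T), injective x /\ range x = A.
Proof.
move=> [k]; rewrite card_eq_sym => /card_bijP[f [f' fK f'K]].
exists k, (fun i => \val (f (ordII i))); split.
  move=> i j /val_inj /(can_inj fK) /(congr1 val) /= ij; exact: val_inj.
apply/seteqP; split=> [_ [i _ <-]|a Aa]; first exact: set_valP.
exists (IIord (f' (SigSub (mem_set Aa)))) => //.
suff -> : ordII (IIord (f' (SigSub (mem_set Aa)))) = f' (SigSub (mem_set Aa)).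
  by rewrite f'K.
exact: val_inj.
Qed.

Lemma finite_set_type (T : Type) (A : set T) :
  finite_set A -> finite_set [set: A].
Proof.
move=> /finite_set_enum[k [x [_ rx]]].
have xA i : A (x i) by rewrite -rx; exists i.
apply: (@sub_finite_set _ _ (range (fun i => SigSub (mem_set (xA i)) : A))).
  move=> a _; have := set_valP a; rewrite -{1}rx => -[i _ xi].
  by exists i => //; apply: val_inj.
exact: finite_image.
Qed.

(** * Pointwise stabilizers, homogeneity and the age *)

Section Homogeneous.
Variables (L : language) (U : Type) (M : structure L U).
Implicit Types (D F X Y : set U).

Lemma stabilizer_id F : stabilizer M F id.
Proof. by split=> //; split; first exists id. Qed.

Lemma stabilizer_comp F g h :
  stabilizer M F g -> stabilizer M F h -> stabilizer M F (g \o h).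
Proof.
move=> [[g_bij g_rel] gF] [[h_bij h_rel] hF]; split; last first.
  by move=> x Fx /=; rewrite hF // gF.
split=> [|l t]; first exact: bij_comp.
by rewrite h_rel g_rel.
Qed.

Lemma stabilizer_inv F g : stabilizer M F g ->
  exists h, [/\ stabilizer M F h, cancel g h & cancel h g].
Proof.
move=> [[[h gK hK] g_rel] gF]; exists h; split=> //; split; last first.
  by move=> x Fx; rewrite -{1}(gF x Fx) gK.
split=> [|l t]; first by exists g.
rewrite (g_rel _ (h \o t)); suff -> : g \o (h \o t) = t by [].
by apply/funext => i /=; rewrite hK.
Qed.

Lemma stabilizer_inj F g : stabilizer M F g -> injective g.
Proof. by move=> [[/bij_inj]]. Qed.

Lemma sub_stabilizer D F g : F `<=` D -> stabilizer M D g -> stabilizer M F g.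
Proof. by move=> FD [gA gD]; split=> // x /FD /gD. Qed.

(** The map [e v] to [e' v] is an isomorphism of finite induced substructures. Indexing both sides
    by a common [V] lets later constructions compare relations on abstract index tuples and never
    mention subtypes. *)
Lemma homogeneous_extension (V : Type) (D : set V) (e e' : V -> U) :
  homogeneous M -> finite_set D ->
  (forall v w, D v -> D w -> e v = e w -> v = w) ->
  (forall v w, D v -> D w -> e' v = e' w -> v = w) ->
  (forall l (t : 'I_(arity l) -> V), (forall i, D (t i)) ->
     rel_of M (e \o t) <-> rel_of M (e' \o t)) ->
  exists2 g, Aut M g & forall v, D v -> g (e v) = e' v.
Proof.
move=> M_hom finD e_inj e'_inj e_rel.
have pre (f : V -> U) (a : f @` D) : {v | D v & f v = \val a}.
  by apply: cid2; have [v] := set_valP a; exists v.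
have preD f (a : f @` D) : D (s2val (pre f a)) by exact: (s2valP (pre f a)).
have preE f (a : f @` D) : f (s2val (pre f a)) = \val a.
  exact: (s2valP' (pre f a)).
pose im (f : V -> U) v (Dv : D v) : f @` D := SigSub (mem_set (imageP f Dv)).
pose h (a : e @` D) := im e' _ (preD e a).
pose h' (a : e' @` D) := im e _ (preD e' a).
have valh a : \val (h a) = e' (s2val (pre e a)) by [].
have valh' a : \val (h' a) = e (s2val (pre e' a)) by [].
have hK : cancel h h'.
  move=> a; apply: val_inj; rewrite valh' -(preE e a); congr e.
  by apply: e'_inj; rewrite ?preE //; exact: preD.
have h'K : cancel h' h.
  move=> a; apply: val_inj; rewrite valh -(preE e' a); congr e'.
  by apply: e_inj; rewrite ?preE //; exact: preD.
have [] := M_hom (e @` D) (e' @` D) h; try exact: finite_image.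
  split=> [|l t /=]; first by exists h'.
  have := e_rel l (fun i => s2val (pre e (t i))) (fun i => preD e _).
  rewrite (_ : e \o _ = (fun i => \val (t i))) //.
  by apply/funext => i /=; rewrite preE.
move=> g g_aut gh; exists g => // v Dv.
have := gh (im e v Dv); rewrite valh /= => ->; congr e'.
by apply: e_inj; rewrite ?preE //; exact: preD.
Qed.

Lemma age_embeddingP (V : Type) (N : structure L V) : finite_set [set: V] ->
  age M N <-> exists2 e : V -> U, injective e &
    forall l (t : 'I_(arity l) -> V), rel_of N t <-> rel_of M (e \o t).
Proof.
move=> finV; split=> [[_ [A [h [h_bij h_rel]]]]|[e e_inj e_rel]].
  exists (\val \o h); first by move=> v w /val_inj /(bij_inj h_bij).
  exact: h_rel.
split=> //; exists (range e).
exists (fun v => SigSub (mem_set (imageP e (I : setT v)))); split; last first.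
  exact: e_rel.
have pre (a : range e) : {v | e v = \val a}.
  by apply: cid; have [v] := set_valP a; exists v.
exists (fun a => sval (pre a)) => [v|a].
  by apply: e_inj; rewrite (svalP (pre _)).
by apply: val_inj; rewrite /= (svalP (pre a)).
Qed.

(** * Freely independent copies over a finite set *)

(** Free amalgamation read inside [M]: when [D] lies in both sets, [X] and [Y] sit in [M] as their
    free amalgam over [D]. *)
Definition free_over D X Y :=
  X `&` Y `<=` D /\
  forall l (t : 'I_(arity l) -> U), rel_of M t ->
    (forall i, (X `|` Y) (t i)) ->
    (exists i, (X `\` D) (t i)) -> (exists i, (Y `\` D) (t i)) -> False.

(** The abstract free amalgam of [X] and [Y] over [D] embeds in [M]; homogeneity then moves the
    embedded [Y] back onto [Y] and sends [X] to the other side. *)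
Lemma free_copy D X Y : homogeneous M -> free_amalgamation (@age L U M) ->
  finite_set X -> finite_set Y -> D `<=` X -> D `<=` Y ->
  exists2 g, stabilizer M D g & free_over D (g @` X) Y.
Proof.
move=> M_hom [_ M_free] finX finY DX DY.
(* [W] carries the points of [D] only once, on the left, so [inY] has to include those left
   points. *)
pose W := (X + (Y `\` D)%classic)%type.
pose p (w : W) : U := match w with inl x => \val x | inr y => \val y end.
pose inX (w : W) := if w is inl _ then True else False.
pose inY (w : W) := if w is inl x then D (\val x) else True.
have pX_inj v w : inX v -> inX w -> p v = p w -> v = w.
  by case: v => // x; case: w => // x' _ _ /val_inj ->.
have pY_inj v w : inY v -> inY w -> p v = p w -> v = w.
  case: v => [x|y]; case: w => [x'|y'] //=.
  - by move=> _ _ /val_inj ->.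
  - by move=> Dx _ exy; have [_ []] := set_valP y'; move: Dx; rewrite exy.
  - by move=> _ Dx exy; have [_ []] := set_valP y; move: Dx; rewrite -exy.
  - by move=> _ _ /val_inj ->.
(* [p] need not be injective, as [X] and [Y] may meet outside [D]. Keeping only the relations on
   tuples within one side is what makes the amalgam free. *)
pose relW l (t : 'I_(arity l) -> W) := rel_of M (p \o t) /\
  ((forall i, inX (t i)) \/ (forall i, inY (t i))).
have relW_inj l (t : 'I_(arity l) -> W) : relW l t -> injective t.
  by move=> [/rel_distinct t_inj _] i j tij; apply: t_inj; rewrite /= tij.
pose C := Structure relW_inj.
have finW : finite_set [set: W].
  apply: (@sub_finite_set _ _ (range (@inl X (Y `\` D)%classic) `|` range inr)).
    by move=> [x|y] _; [left; exists x | right; exists y].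
  rewrite finite_setU; split; apply: finite_image; apply: finite_set_type => //.
  exact: finite_setD.
have finT (A : set W) : finite_set [set: A].
  by apply: finite_set_type; exact: sub_finite_set finW.
have Cfree : is_free_amalgam C inX inY.
  split; first by apply/seteqP; split=> // -[x|y] _; [left | right].
  by move=> l t [i [_ iY]] [j [_ jX]] [_ [/(_ j)|/(_ i)]].
have KX : age M (induced C inX).
  apply/age_embeddingP => //; exists (p \o \val).
    by move=> v w /pX_inj vw; apply: val_inj; apply: vw; exact: set_valP.
  move=> l t; split=> [[] //|t_rel]; split=> //; left=> i; exact: set_valP.
have KY : age M (induced C inY).
  apply/age_embeddingP => //; exists (p \o \val).
    by move=> v w /pY_inj vw; apply: val_inj; apply: vw; exact: set_valP.
  move=> l t; split=> [[] //|t_rel]; split=> //; right=> i; exact: set_valP.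
have /(age_embeddingP _ finW)[e e_inj e_rel] := M_free W C inX inY Cfree KX KY.
(* [g1] undoes the embedding [e] on the side of [Y]; after it, [g2] sends [X] to its copy, and [g2]
   fixes [D] because these points also lie on the side of [Y]. *)
have [||||g1 g1_aut g1e] := @homogeneous_extension W inY e p M_hom.
- exact: sub_finite_set finW.
- by move=> v w _ _; exact: e_inj.
- exact: pY_inj.
- by move=> l t tY; rewrite -e_rel; split=> [[] //|t_rel]; split=> //; right.
have [||||g2 g2_aut g2p] := @homogeneous_extension W inX p (g1 \o e) M_hom.
- exact: sub_finite_set finW.
- exact: pX_inj.
- move=> v w _ _ /(bij_inj (proj1 g1_aut)); exact: e_inj.
- move=> l t tX; rewrite -compA -(proj2 g1_aut) -e_rel.
  by split=> [t_rel|[] //]; split=> //; left.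
have g2E x (Xx : X x) : g2 x = g1 (e (inl (SigSub (mem_set Xx)))).
  exact: (g2p (inl (SigSub (mem_set Xx))) I).
have g1E w : inY w -> p w = g1 (e w) by move=> /g1e ->.
have pY' y : Y y -> exists2 w, inY w & p w = y.
  move=> Yy; have [Dy|Dy] := pselect (D y).
    by exists (inl (SigSub (mem_set (DX _ Dy)))).
  by exists (inr (SigSub (mem_set (conj Yy Dy : (Y `\` D)%classic y)))).
have g1e_inj : injective (g1 \o e).
  by apply: inj_comp => //; exact: bij_inj (proj1 g1_aut).
exists g2; first split=> // x Dx.
  have Xx := DX _ Dx; rewrite g2E.
  by rewrite -(g1E (inl (SigSub (mem_set Xx)))).
split=> [u [[x Xx <-]]|l t t_rel tXY [i [[x Xx tx] iD]] [j [jY jD]]].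
  rewrite g2E => /pY'[w wY]; rewrite (g1E _ wY) => /g1e_inj wx.
  by move: wY; rewrite wx => xY; rewrite -(g1E _ xY).
(* A relation of [M] on the two copies pulls back to the amalgam, where freeness forbids it. *)
have pre k : {w | g1 (e w) = t k}.
  apply: cid; have [[y Xy <-]|/pY'[w wY <-]] := tXY k.
    by exists (inl (SigSub (mem_set Xy))); rewrite g2E.
  by exists w; rewrite -g1E.
have : rel_of C (fun k => sval (pre k)).
  rewrite e_rel (proj2 g1_aut) (_ : g1 \o _ = t) //.
  by apply/funext => k /=; rewrite (svalP (pre k)).
apply: (proj2 Cfree); [exists i | exists j].
  have -> : sval (pre i) = inl (SigSub (mem_set Xx)).
    by apply: g1e_inj; rewrite /= (svalP (pre i)) -g2E.
  split=> // xY; apply: iD.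
  by rewrite -tx g2E -g1E.
have [w wY wtj] := pY' _ jY.
have -> : sval (pre j) = w.
  by apply: g1e_inj; rewrite /= (svalP (pre j)) -g1E.
split=> [|wX]; first exact: wY.
by apply: jD; rewrite -wtj; case: w wX wY {wtj}.
Qed.

(** The sets are placed one after the other, each by a free copy over [D] against the union of all
    the others. *)
Lemma independent_copies (I : finType) D (Z : I -> set U) :
  homogeneous M -> free_amalgamation (@age L U M) ->
  finite_set D -> (forall i, finite_set (Z i)) ->
  exists h : I -> U -> U,
  [/\ forall i, stabilizer M D (h i),
      forall i j u, ~ D u -> (h i @` Z i) u -> (h j @` Z j) u -> i = j
    & forall l (t : 'I_(arity l) -> U), rel_of M t ->
      (forall p, D (t p) \/ exists i, (h i @` Z i) (t p)) ->
      forall p q i j, ~ D (t p) -> ~ D (t q) ->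
        (h i @` Z i) (t p) -> (h j @` Z j) (t q) -> i = j].
Proof.
move=> M_hom M_free finD finZ.
suff [h [hD h_disj h_rel]] : exists h : I -> U -> U,
  [/\ forall i, stabilizer M D (h i),
      forall i j u, i \in enum I -> j \in enum I -> ~ D u ->
        (h i @` Z i) u -> (h j @` Z j) u -> i = j
    & forall l (t : 'I_(arity l) -> U), rel_of M t ->
      (forall p, D (t p) \/ exists2 i, i \in enum I & (h i @` Z i) (t p)) ->
      forall p q i j, i \in enum I -> j \in enum I -> ~ D (t p) -> ~ D (t q) ->
        (h i @` Z i) (t p) -> (h j @` Z j) (t q) -> i = j].
  exists h; split=> //.
    by move=> i j u; apply: h_disj; rewrite mem_enum.
  move=> l t t_rel tZ p q i j; apply: (h_rel l t t_rel); rewrite ?mem_enum //.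
  move=> r; have [?|[k Zk]] := tZ r; [by left|right].
  by exists k; rewrite ?mem_enum.
elim: (enum I) => [|k s [h [hD h_disj h_rel]]].
  by exists (fun _ => id); split=> // i; exact: stabilizer_id.
have [ks|ks] := boolP (k \in s).
  exists h; split=> //.
    by move=> i j u; rewrite !inE => /predU1P[->|is_] /predU1P[->|js] //;
       exact: h_disj.
  move=> l t t_rel tZ p q i j.
  rewrite !inE => /predU1P ik /predU1P jk; apply: (h_rel l t t_rel).
  - move=> r; have [?|[m + Zm]] := tZ r; [by left|rewrite inE => ms; right].
    by exists m => //; case/predU1P: ms => [->|].
  - by case: ik => [->|].
  - by case: jk => [->|].
(* The union also includes indices not yet treated; a larger [W] only strengthens the freeness
   obtained. *)
pose W := D `|` \bigcup_i (h i @` Z i).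
have finW : finite_set W.
  rewrite finite_setU; split=> //; apply: bigcup_finite => // i _.
  exact: finite_image.
have [||||g gD [g_disj g_rel]] := @free_copy D (D `|` Z k) W M_hom M_free.
- by rewrite finite_setU.
- by [].
- exact: subsetUl.
- exact: subsetUl.
pose h' i := if i == k then g else h i.
have h'k : h' k = g by rewrite /h' eqxx.
have h's i : i \in s -> h' i = h i.
  by rewrite /h'; case: eqP => // -> ks'; rewrite ks' in ks.
have sW i u : (h i @` Z i) u -> W u by move=> hu; right; exists i.
have gZ u : (g @` Z k) u -> (g @` (D `|` Z k)) u.
  by move=> [z Zz <-]; exists z => //; right.
have gU u : D u \/ (exists2 i, i \in k :: s & (h' i @` Z i) u) ->
    (g @` (D `|` Z k) `|` W) u.
  move=> [Du|[i]]; first by right; left.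
  rewrite inE => /predU1P[->|/h's ->]; first by rewrite h'k => /gZ; left.
  by move=> /sW; right.
exists h'; split.
- by move=> i; rewrite /h'; case: eqP.
- move=> i j u; rewrite !inE => /predU1P[->|si] /predU1P[->|sj] // nD.
  + by rewrite h'k h's // => /gZ gu /sW Wu; have := g_disj u (conj gu Wu).
  + by rewrite h'k h's // => /sW Wu /gZ gu; have := g_disj u (conj gu Wu).
  + by rewrite !h's //; exact: h_disj.
- move=> l t t_rel tZ p q i j.
  have no p' q' i' : i' \in s -> ~ D (t p') -> ~ D (t q') ->
      (g @` Z k) (t p') -> (h i' @` Z i') (t q') -> False.
    move=> si nDp nDq /gZ gp /sW Wq; apply: (g_rel l t t_rel).
    + by move=> r; apply: gU.
    + by exists p'.
    + by exists q'.
  rewrite !inE => /predU1P[->|si] /predU1P[->|sj] // nDp nDq.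
  + by rewrite h'k h's // => gp hq; case: (no p q j).
  + by rewrite h'k h's // => hp gq; case: (no q p i).
  rewrite !h's // => hp hq; apply: (h_rel l t t_rel _ p q) => // r.
  (* An entry in the new copy must lie in [D], since [t p] is in an old copy outside [D]; so the
     induction hypothesis applies to [t]. *)
  have [?|[m]] := tZ r; [by left|rewrite inE => /predU1P[->|sm]].
    rewrite h'k => gr; have [Dr|nDr] := pselect (D (t r)); first by left.
    by case: (no r p i).
  by rewrite h's //; right; exists m.
Qed.

(** * Orbits of the stabilizer and their free subsets *)

Definition orbit F o : set U := [set g o | g in stabilizer M F].

Lemma orbit_refl F o : orbit F o o.
Proof. by exists id; first exact: stabilizer_id. Qed.

Lemma orbit_stabilizer F o g u :
  stabilizer M F g -> orbit F o (g u) <-> orbit F o u.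
Proof.
move=> gF; split=> [[k kF ku]|[k kF <-]]; last first.
  by exists (g \o k) => //; exact: stabilizer_comp.
have [g' [g'F gK _]] := stabilizer_inv gF.
exists (g' \o k); first exact: stabilizer_comp.
by rewrite /= ku gK.
Qed.

Lemma orbit_notin F o u : ~ F o -> orbit F o u -> ~ F u.
Proof.
move=> nFo [g gF <-] Fgo; apply: nFo.
by rewrite -(stabilizer_inj gF ((proj2 gF) _ Fgo)).
Qed.

(* Relations of [M] hold on distinct entries only, so the conclusion [t p = t q]
   says that no relation with entries in [F `|` X] meets two points of [X]. *)
Definition free_set F X := forall l (t : 'I_(arity l) -> U), rel_of M t ->
  (forall p, (F `|` X) (t p)) -> forall p q, X (t p) -> X (t q) -> t p = t q.

Lemma sub_free_set F X Y : X `<=` Y -> free_set F Y -> free_set F X.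
Proof.
move=> XY FY l t t_rel tX p q /XY Yp /XY Yq; apply: (FY l t t_rel) => // r.
by have [?|/XY] := tX r; [left|right].
Qed.

Lemma free_set_stabilizer F X g : stabilizer M F g ->
  free_set F X -> free_set F (g @` X).
Proof.
move=> gF FX l t t_rel tX p q [x Xx xp] [y Xy yq].
have [k [kF gK kK]] := stabilizer_inv gF.
rewrite -[t p]kK -[t q]kK; congr g; apply: (FX l (k \o t)) => /=.
- by rewrite -(proj2 (proj1 kF)).
- move=> r; have [Fr|[z Xz <-]] := tX r; last by rewrite gK; right.
  by rewrite (proj2 kF) //; left.
- by rewrite -xp gK.
- by rewrite -yq gK.
Qed.

(** A relation over [F] and a free set involves at most one point of that set, and single points of
    the orbit look alike over [F]. So [x i] to [y i], with the identity on [F], is a partial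
    isomorphism. *)
Lemma free_orbit_homogeneous (I : finType) F o (x y : I -> U) :
  homogeneous M -> finite_set F -> ~ F o -> injective x -> injective y ->
  (forall i, orbit F o (x i)) -> (forall i, orbit F o (y i)) ->
  free_set F (range x) -> free_set F (range y) ->
  exists2 g, stabilizer M F g & forall i, g (x i) = y i.
Proof.
move=> M_hom finF nFo x_inj y_inj xo yo x_free y_free.
pose e (z : I -> U) (v : U + I) := match v with inl u => u | inr i => z i end.
pose D : set (U + I) := (inl @` F) `|` range inr.
have e_inj z : injective z -> (forall i, orbit F o (z i)) ->
    forall v w, D v -> D w -> e z v = e z w -> v = w.
  move=> z_inj zo v w [[u Fu <-]|[i _ <-]] [[u' Fu' <-]|[j _ <-]] /=.
  - by move=> ->.
  - by move=> uz; case: (orbit_notin nFo (zo j)); rewrite -uz.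
  - by move=> zu; case: (orbit_notin nFo (zo i)); rewrite zu.
  - by move=> /z_inj ->.
have e_rel z z' : injective z -> free_set F (range z) ->
    (forall i, orbit F o (z i)) -> (forall i, orbit F o (z' i)) ->
    forall l (t : 'I_(arity l) -> U + I), (forall p, D (t p)) ->
    rel_of M (e z \o t) -> rel_of M (e z' \o t).
  move=> z_inj z_free zo z'o l t tD t_rel.
  have [[p [i tp]]|tF] := pselect (exists p i, t p = inr i); last first.
    rewrite (_ : e z' \o t = e z \o t) //; apply/funext => r /=.
    by case tr : (t r) => [//|i]; case: tF; exists r, i.
  (* [i] is the only index occurring in [t], so a single element of the stabilizer, carrying [z i]
     to [z' i], moves the whole tuple. *)
  have [a aF az] := zo i; have [b bF bz] := z'o i.
  have [a' [a'F aK _]] := stabilizer_inv aF.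
  have [[_ ba_rel] baF] := stabilizer_comp bF a'F.
  rewrite (_ : e z' \o t = (b \o a') \o (e z \o t)) -?ba_rel //.
  apply/funext => r /=; case tr : (t r) => [u|j] /=.
    have := tD r; rewrite tr => -[[u' Fu [uu']]|[] //].
    by rewrite -uu' -[in LHS](baF _ Fu).
  suff -> : j = i by rewrite -az aK bz.
  apply: z_inj; have := z_free _ _ t_rel _ r p; rewrite /= tr tp /=; apply.
  - by move=> q; have [[u Fu <-]|[k _ <-]] := tD q; [left|right; exists k].
  - by exists j.
  - by exists i.
have [||||g gA gE] := @homogeneous_extension _ D (e x) (e y) M_hom.
- by rewrite finite_setU; split; apply: finite_image => //;
     exact: finite_finset.
- exact: e_inj.
- exact: e_inj.
- by move=> l t tD; split; exact: e_rel.
exists g; first split=> // u Fu.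
  by apply: (gE (inl u)); left; exists u.
by move=> i; apply: (gE (inr i)); right; exists i.
Qed.

(** * The partite construction for one orbit *)

(** The partite systems of the partite construction. Relations across different parts are
    unrestricted, and [Z] may have points outside all parts. *)
Definition partite (I : Type) F o Z (X : I -> set U) :=
  [/\ finite_set Z,
      forall s, [/\ X s `<=` Z, X s `<=` orbit F o & free_set F (X s)]
    & forall s s' u, X s u -> X s' u -> s = s'].

(** Copies independent over [D] have no relation across two of them outside [D], so the union of the
    parts with the same index stays free. The parts avoid [D] so that copies of them cannot
    overlap. *)
Lemma partite_copies (I : Type) (J : finType) F D o
    (W : J -> set U) (Q : J -> I -> set U) :
  homogeneous M -> free_amalgamation (@age L U M) ->
  F `<=` D -> finite_set D -> (forall j, finite_set (W j)) ->
  (forall j s, [/\ Q j s `<=` W j, Q j s `<=` orbit F o,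
     free_set F (Q j s) & Q j s `<=` ~` D]) ->
  (forall j s s' u, Q j s u -> Q j s' u -> s = s') ->
  exists h : J -> U -> U, [/\ forall j, stabilizer M D (h j),
    partite F o (\bigcup_j (h j @` W j)) (fun s => \bigcup_j (h j @` Q j s))
    & forall s, \bigcup_j (h j @` Q j s) `<=` ~` D].
Proof.
move=> M_hom M_free FD finD finW QP Q_disj.
have [h [hD h_disj h_rel]] := independent_copies M_hom M_free finD finW.
have hF j : stabilizer M F (h j) := sub_stabilizer FD (hD j).
have hQW j s : h j @` Q j s `<=` h j @` W j.
  by have [QW _ _ _] := QP j s; exact: image_subset.
have hQD j s : h j @` Q j s `<=` ~` D.
  have [_ _ _ QD] := QP j s; move=> _ [u Qu <-] Du; apply: (QD _ Qu).
  by rewrite -(stabilizer_inj (hD j) ((proj2 (hD j)) _ Du)).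
exists h; split=> //; last by move=> s u [j _ /hQD].
split.
- by apply: bigcup_finite => // j _; exact: finite_image.
- move=> s; split.
  + by move=> u [j _ /hQW Wu]; exists j.
  + move=> _ [j _ [u Qu <-]]; rewrite orbit_stabilizer //.
    by have [_ Qo _ _] := QP j s; exact: Qo.
  + move=> l t t_rel tX p q [j _ Qp] [j' _ Qq].
    have tD r : D (t r) \/ exists i, (h i @` W i) (t r).
      by have [/FD|[i _ /hQW]] := tX r; [left|right; exists i].
    (* All entries of [t] in the part come from one copy, where freeness is already known. *)
    have same r i : (h i @` Q i s) (t r) -> i = j.
      move=> Qr; apply: (h_rel l t t_rel tD r p); first exact: hQD Qr.
      + exact: hQD Qp.
      + exact: hQW Qr.
      + exact: hQW Qp.
    have [_ _ Qfree _] := QP j s.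
    apply: (free_set_stabilizer (hF j) Qfree t_rel) => //.
    * by move=> r; have [?|[i _ Qr]] := tX r; [left|right; rewrite -(same r i)].
    * by rewrite -(same q j').
- move=> s s' u [j _ Qu] [j' _ Qu'].
  have jj' : j = j'.
    by apply: (h_disj j j' u); [exact: hQD Qu|exact: hQW Qu|exact: hQW Qu'].
  case: Qu Qu'; rewrite -jj' => a Qa <- [a' Qa' /(stabilizer_inj (hD j)) aa'].
  by apply: (Q_disj j s s' a) => //; rewrite -aa'.
Qed.

Lemma free_orbit_points (n : nat) F o :
  homogeneous M -> free_amalgamation (@age L U M) -> finite_set F -> ~ F o ->
  exists y : 'I_n -> U,
    [/\ injective y, forall i, orbit F o (y i) & free_set F (range y)].
Proof.
move=> M_hom M_free finF nFo.
have [h [hF h_disj h_rel]] := independent_copies M_hom M_free finF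
  (fun _ : 'I_n => finite_set1 o).
have yo i : orbit F o (h i o).
  by rewrite orbit_stabilizer //; exact: orbit_refl.
have nFy i := orbit_notin nFo (yo i).
exists (fun i => h i o); split=> //.
  by move=> i j hij; apply: (h_disj i j (h i o)) => //; exists o.
move=> l t t_rel tY p q [i _ tp] [j _ tq]; rewrite -tp -tq.
suff -> : i = j by [].
apply: (h_rel l t t_rel _ p q); rewrite -?tp -?tq //.
- by move=> r; have [?|[k _ <-]] := tY r; [left|right; exists k, o].
- by exists o.
- by exists o.
Qed.

(** A finite type, so that one copy can be prepared in advance for every outcome of the pigeonhole
    principle. *)
Definition injections k n : finType := {f : {ffun 'I_k -> 'I_n} | injectiveb f}.

Lemma injections_inj k n (f : injections k n) : injective (val f).
Proof. by apply/injectiveP; exact: (valP f). Qed.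

Lemma pigeonhole_injection (R : finType) (r0 : R) k (c : 'I_(#|R| * k) -> R) :
  exists (f : injections k (#|R| * k)) r, forall i, c (val f i) = r.
Proof.
have [r kr] : exists r, (k <= #|[pred i | c i == r]|)%N.
  apply: contrapT => /forallNP small.
  have E : #|R| * k = \sum_(r : R) #|[pred i | c i == r]|.
    rewrite -[LHS](card_ord (#|R| * k)) -sum1_card (partition_big c predT) //=.
    by apply: eq_bigr => r _; rewrite sum1_card.
  suff : (\sum_(r : R) #|[pred i | c i == r]| < \sum_(r : R) k)%N.
    by rewrite -E sum_nat_const ltnn.
  (* One strict term suffices for the strict inequality of sums; [r0] supplies it. *)
  rewrite (bigD1 r0) //= [ltnRHS](bigD1 r0) //= -addSn.
  apply: leq_add; first by rewrite ltnNge; apply/negP/small.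
  by apply: leq_sum => r _; rewrite leqNgt; apply/negP => /ltnW /small.
pose f := [ffun i : 'I_k => enum_val (widen_ord kr i)].
have f_inj : injectiveb f.
  apply/injectiveP => i j; rewrite !ffunE => /enum_val_inj /(congr1 val) /= ij.
  exact: val_inj.
exists (exist _ f f_inj), r => i /=; rewrite ffunE.
by have := enum_valP (widen_ord kr i); rewrite inE => /eqP.
Qed.

Definition constant_on (R : Type) (c : U -> R) X :=
  forall u v, X u -> X v -> c u = c v.

(** The part at [s0] is enlarged to a free set [range y] so big that any colouring is constant on as
    many points as [X s0] has, and a copy of [Z] is attached along every injection of [X s0] into
    it. The other parts keep their indices, which lets the step be iterated. *)
Lemma partite_step (R : finType) (r0 : R) (I : eqType) F o Z (X : I -> set U)
    (s0 : I) :
  homogeneous M -> free_amalgamation (@age L U M) -> finite_set F -> ~ F o ->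
  partite F o Z X ->
  exists Z' (X' : I -> set U), partite F o Z' X' /\
    forall c : U -> R, exists2 g, stabilizer M F g &
      [/\ g @` Z `<=` Z', forall s, g @` X s `<=` X' s
        & constant_on c (g @` X s0)].
Proof.
move=> M_hom M_free finF nFo [finZ XP X_disj].
have [XZ0 Xo0 Xfree0] := XP s0.
have [k [x [x_inj xX]]] := finite_set_enum (sub_finite_set XZ0 finZ).
have Xx i : X s0 (x i) by rewrite -xX; exists i.
have [y [y_inj yo y_free]] :=
  @free_orbit_points (#|R| * k) F o M_hom M_free finF nFo.
have nFy i := orbit_notin nFo (yo i).
have finFY : finite_set (F `|` range y).
  by rewrite finite_setU; split=> //; apply: finite_image; exact: finite_finset.
(* For each [f], a copy of [Z] with [X s0] placed on the points of [y] selected by [f], meeting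
   [range y] only in points from [X s0]. *)
have copy (f : injections k (#|R| * k)) : {g | stabilizer M F g &
    (forall i, g (x i) = y (val f i)) /\
    (forall z, Z z -> range y (g z) -> X s0 z)}.
  apply: cid2.
  have [||||||g gF gx] :=
    @free_orbit_homogeneous _ F o x (y \o val f) M_hom finF nFo.
  - by [].
  - by apply: inj_comp => //; exact: injections_inj.
  - by move=> i; exact: Xo0.
  - by move=> i; exact: yo.
  - by rewrite xX.
  - by apply: sub_free_set y_free => _ [i _ <-]; exists (val f i).
  (* Moving [g @` Z] away from [range y] over the image of [X s0] keeps the
     other parts disjoint from the new part [range y]. *)
  pose D := F `|` (y \o val f) @` setT.
  have [||||u uD [u_disj _]] :=
    @free_copy D (F `|` g @` Z) (F `|` range y) M_hom M_free.
  - by rewrite finite_setU; split=> //; exact: finite_image.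
  - by [].
  - move=> v [?|[i _ <-]]; [by left|right]; exists (x i); last exact: gx.
    exact: XZ0.
  - by move=> v [?|[i _ <-]]; [left|right; exists (val f i)].
  have uF : stabilizer M F u by apply: sub_stabilizer uD; exact: subsetUl.
  exists (u \o g); first exact: stabilizer_comp.
  split=> [i /=|z Zz yz].
    by rewrite gx (proj2 uD) //; right; exists i.
  have [|Fz|[i _ /= yi]] := u_disj (u (g z)).
  - by split; [exists (g z) => //; right; exists z|right].
  - by case: yz Fz => i _ /= <- /nFy.
  - suff -> : z = x i by [].
    apply/(stabilizer_inj gF)/(stabilizer_inj uD); rewrite gx -yi.
    by rewrite (proj2 uD) //; right; exists i.
pose g f := s2val (copy f).
have gF f : stabilizer M F (g f) := s2valP (copy f).
have gx f i : g f (x i) = y (val f i) := proj1 (s2valP' (copy f)) i.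
have gY f z : Z z -> range y (g f z) -> X s0 z := proj2 (s2valP' (copy f)) z.
(* The new part at [s0] is [range y] itself, inside the base of the amalgam, so only the other parts
   are handed to [partite_copies]. *)
pose Q f s := if s == s0 then set0 else g f @` X s.
have [|||||h [hD [finW WP W_disj] WD]] :=
  @partite_copies I _ F (F `|` range y) o (fun f => g f @` Z) Q M_hom M_free.
- exact: subsetUl.
- by [].
- by move=> f; exact: finite_image.
- move=> f s; rewrite /Q; case: eqP => [_|ss0].
    split; try exact: sub0set.
    by move=> l t _ _ p q [].
  have [XZ Xo Xfree] := XP s; split.
  + exact: image_subset.
  + by move=> _ [u /Xo uo <-]; rewrite orbit_stabilizer.
  + exact: free_set_stabilizer.
  + move=> _ [u Xu <-] [|Yu].
      apply: (@orbit_notin F o) => //; rewrite orbit_stabilizer //.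
      exact: Xo.
    by apply: ss0; apply: (X_disj _ _ u) => //; apply: (gY f) => //; exact: XZ.
- move=> f s s' u; rewrite /Q; case: eqP => // _; case: eqP => // _.
  move=> [v Xv <-] [w Xw /(stabilizer_inj (gF f)) wv].
  by apply: (X_disj _ _ v) => //; rewrite -wv.
have hF f : stabilizer M F (h f).
  by apply: sub_stabilizer (hD f); exact: subsetUl.
exists (range y `|` \bigcup_f (h f @` (g f @` Z))).
exists (fun s => if s == s0 then range y else \bigcup_f (h f @` Q f s)).
split; last first.
  move=> c; have [f [r cr]] := pigeonhole_injection r0 (c \o y).
  have hgx i : h f (g f (x i)) = y (val f i).
    by rewrite gx (proj2 (hD f)) //; right; exists (val f i).
  exists (h f \o g f); first exact: stabilizer_comp.
  split.
  - by move=> _ [z Zz <-]; right; exists f => //; exists (g f z).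
  - move=> s _ [z Xz <-]; case: eqP => [ss0|/eqP/negbTE ss0].
      by move: Xz; rewrite ss0 -xX => -[i _ <-] /=; exists (val f i).
    exists f => //; exists (g f z) => //; rewrite /Q ss0; by exists z.
  - have cX u : ((h f \o g f) @` X s0) u -> c u = r.
      by rewrite -xX => -[_ [i _ <-] <-] /=; rewrite hgx -(cr i).
    by move=> u v /cX -> /cX ->.
split.
- by rewrite finite_setU; split=> //; apply: finite_image; exact: finite_finset.
- move=> s; case: eqP => _; first by split=> // _ [i _ <-] //; left; exists i.
  by have [WZ Wo Wfree] := WP s; split=> // u /WZ; right.
- move=> s s' u; case: eqP => [->|_]; case: eqP => [->|_] //.
  + by move=> yu /WD; case; right.
  + by move=> /WD nu yu; case: nu; right.
  + exact: W_disj.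
Qed.

(** A part made constant stays so: every later copy is taken of the whole system, and it maps each
    part into the part with the same index. *)
Lemma partite_constant (R : finType) (r0 : R) (I : eqType) F o Z
    (X : I -> set U) (s : seq I) :
  homogeneous M -> free_amalgamation (@age L U M) -> finite_set F -> ~ F o ->
  partite F o Z X ->
  exists2 C, finite_set C & forall c : U -> R, exists2 g, stabilizer M F g &
    g @` Z `<=` C /\ forall i, i \in s -> constant_on c (g @` X i).
Proof.
move=> M_hom M_free finF nFo; elim: s Z X => [|i s IHs] Z X ZX.
  exists Z => [|c]; first by case: ZX.
  by exists id; [exact: stabilizer_id|rewrite image_id; split].
have [Z' [X' [ZX' step]]] := partite_step r0 i M_hom M_free finF nFo ZX.
have [C finC CP] := IHs Z' X' ZX'; exists C => // c.
have [g gF [gZ gX]] := CP c.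
(* The system built first is coloured last, through the copy [g] of it found in [C]. *)
have [g' g'F [g'Z g'X g'i]] := step (c \o g).
exists (g \o g'); first exact: stabilizer_comp.
split=> [|j].
  by move=> _ [z Zz <-]; apply: gZ; exists (g' z) => //; apply: g'Z; exists z.
rewrite inE => /predU1P[->|sj] _ _ [u Xu <-] [v Xv <-].
  by apply: g'i; [exists u|exists v].
apply: (gX j sj); [exists (g' u)|exists (g' v)] => //; apply: g'X.
  by exists u.
by exists v.
Qed.

(** Once every part is constant the colour depends on the part only, and a second pigeonhole, now on
    the parts, picks the right copy of [A]. *)
Lemma orbit_constant (R : finType) (r0 : R) F o A :
  homogeneous M -> free_amalgamation (@age L U M) -> finite_set F -> ~ F o ->
  finite_set A ->
  exists2 C, finite_set C & forall c : U -> R, exists2 g, stabilizer M F g &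
    g @` A `<=` C /\ constant_on c (g @` (A `&` orbit F o)).
Proof.
move=> M_hom M_free finF nFo finA.
have [k [a [a_inj aA]]] := finite_set_enum (finite_setIl (orbit F o) finA).
have Aa i : (A `&` orbit F o) (a i) by rewrite -aA; exists i.
(* The copy for [f] puts [a i] into part [f i]; injectivity leaves at most one point per part, so
   the parts are trivially free. *)
pose Q (f : injections k (#|R| * k)) s :=
  [set a i | i in [set i | val f i = s]].
have [|||||h [hF ZX _]] :=
  @partite_copies 'I_(#|R| * k) _ F F o (fun _ => A) Q M_hom M_free.
- by [].
- by [].
- by [].
- move=> f s; split.
  + by move=> _ [i _ <-]; have [] := Aa i.
  + by move=> _ [i _ <-]; have [] := Aa i.
  + move=> l t _ _ p q [i fi <-] [j fj <-]; congr a.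
    by apply: (@injections_inj _ _ f); rewrite fi fj.
  + by move=> _ [i _ <-]; apply: (orbit_notin nFo); have [] := Aa i.
- by move=> f s s' u [i <- <-] [j <- /a_inj ->].
have [C finC CP] :=
  partite_constant r0 (enum 'I_(#|R| * k)) M_hom M_free finF nFo ZX.
exists C => // c; have [g gF [gC gX]] := CP c.
have hX (f : injections k (#|R| * k)) i :
    (\bigcup_f' (h f' @` Q f' (val f i))) (h f (a i)).
  by exists f => //; exists (a i) => //; exists i.
pose X s := \bigcup_f (h f @` Q f s).
(* An empty part gets the default colour [r0]. *)
have part_colour s : {r | forall u, X s u -> c (g u) = r}.
  apply: cid; have [[u Xu]|noX] := pselect (exists u, X s u).
    exists (c (g u)) => v Xv.
    by apply: (gX s); [rewrite mem_enum|exists v|exists u].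
  by exists r0 => u Xu; case: noX; exists u.
have [f [r fr]] := pigeonhole_injection r0 (fun s => sval (part_colour s)).
exists (g \o h f); first exact: stabilizer_comp.
split=> [_ [z Az <-]|].
  by apply: gC; exists (h f z) => //; exists f => //; exists z.
have cr u : ((g \o h f) @` (A `&` orbit F o)) u -> c u = r.
  rewrite -aA => -[_ [i _ <-] <-] /=.
  by rewrite (svalP (part_colour _) _ (hX f i)); exact: fr.
by move=> u v /cr -> /cr ->.
Qed.

(** Stabilizer elements preserve every orbit, so treating one orbit does not spoil constancy on the
    others. *)
Lemma orbits_constant (R : finType) (r0 : R) (I : eqType) F (o : I -> U) A
    (s : seq I) :
  homogeneous M -> free_amalgamation (@age L U M) -> finite_set F ->
  (forall i, ~ F (o i)) -> finite_set A ->
  exists2 C, finite_set C & forall c : U -> R, exists2 g, stabilizer M F g &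
    g @` A `<=` C /\
    forall i, i \in s -> constant_on c (g @` (A `&` orbit F (o i))).
Proof.
move=> M_hom M_free finF nFo; elim: s A => [|i s IHs] A finA.
  exists A => // c; exists id; first exact: stabilizer_id.
  by split=> [_ [u Au <-]|].
have [A' finA' step] := orbit_constant r0 M_hom M_free finF (nFo i) finA.
have [C finC CP] := IHs A' finA'; exists C => // c.
have [g gF [gA' gs]] := CP c; have [g' g'F [g'A g'i]] := step (c \o g).
exists (g \o g'); first exact: stabilizer_comp.
split=> [|j].
  by move=> _ [z Az <-]; apply: gA'; exists (g' z) => //; apply: g'A; exists z.
rewrite inE => /predU1P[->|sj] _ _ [u [Au ou] <-] [v [Av ov] <-].
  by apply: g'i; [exists u|exists v].
apply: (gs j sj); [exists (g' u)|exists (g' v)] => //.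
  by split; [apply: g'A; exists u|rewrite orbit_stabilizer].
by split; [apply: g'A; exists v|rewrite orbit_stabilizer].
Qed.

(** * Colourings of bundles *)

Lemma btypesetE n (B : bundle U n) :
  btypeset M B = \bigcup_j orbit (bsockel B) (Defs.point (btype B j)).
Proof. by apply: eq_bigcupr => j _; rewrite /typeset btype_sockel. Qed.

Lemma selection_sub n (B : bundle U n) S (P : colouring M B S)
    (e : selector P) : selection e `<=` S.
Proof.
move=> u [j _ Pu].
have : (\bigcup_i part (c := P) (j := j) i) u by exists (e j).
by rewrite part_cover => -[].
Qed.

Lemma rho_bar_sub n (B : bundle U n) S S' :
  S `<=` S' -> rho_bar M B S `<=` rho_bar M B S'.
Proof.
move=> SS' A [finA AB [g gB gA]]; split=> //; exists g => //.
exact: subset_trans SS'.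
Qed.

Lemma finite_selector n (B : bundle U n) S (P : colouring M B S) A :
  homogeneous M -> free_amalgamation (@age L U M) ->
  rho_bar M B S = rho_bar M B (btypeset M B) ->
  finite_set A -> A `<=` btypeset M B ->
  exists e : selector P, rho_bar M B (selection e) A.
Proof.
move=> M_hom M_free rhoS finA AB.
set F := bsockel B; pose o j := Defs.point (btype B j).
have nFo j : ~ F (o j) by rewrite /F -(btype_sockel B j); exact: point_notin.
have oB j : orbit F (o j) `<=` btypeset M B.
  by move=> u ou; rewrite btypesetE; exists j.
have gB g u : stabilizer M F g -> btypeset M B u -> btypeset M B (g u).
  move=> gF; rewrite btypesetE => -[j _ ju]; exists j => //.
  by rewrite orbit_stabilizer.
(* The representatives [o j] determine the colour selected for each type. *)
pose A' := A `|` range o.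
have finA' : finite_set A'.
  by rewrite finite_setU; split=> //; apply: finite_image; exact: finite_finset.
have A'B : A' `<=` btypeset M B.
  by move=> u [/AB //|[j _ <-]]; apply: (oB j); exact: orbit_refl.
(* [None] colours the points outside every part. *)
pose R : finType := option {j : 'I_n & 'I_(ncolours P j)}.
have [C finC CP] :=
  orbits_constant (None : R) (enum 'I_n) M_hom M_free (bsockel_finite B) nFo
    finA'.
(* The hypothesis on [S] yields [k] moving this finite set into [S]; points are then coloured by the
   part containing their image under [k]. *)
have : rho_bar M B (btypeset M B) (C `&` btypeset M B).
  split; [exact: finite_setIl|exact: subIsetr|].
  by exists id; [exact: stabilizer_id|rewrite image_id; exact: subIsetr].
rewrite -rhoS => -[_ _ [k kF kC]].
pose owner (ij : {j : 'I_n & 'I_(ncolours P j)}) := part (tagged ij).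
have colour u : {r : R | forall ij, owner ij u <-> r = Some ij}.
  apply: cid; have [[ij Pu]|noP] := pselect (exists ij, owner ij u); last first.
    by exists None => ij; split=> // Pu; case: noP; exists ij.
  exists (Some ij) => ij'; split=> [Pu'|[<-] //]; congr Some.
  by apply: (@part_disjoint _ _ _ _ _ _ P) => //; exists u.
have [g gF [gC gconst]] := CP (fun u => sval (colour (k u))).
have kgS u : A' u -> S (k (g u)).
  move=> A'u; apply: kC; exists (g u) => //; split.
    by apply: gC; exists u.
  by apply: gB => //; exact: A'B.
have rep j : {i : 'I_(ncolours P j) | owner (Tagged _ i) (k (g (o j)))}.
  apply: cid.
  have : (S `&` typeset M (btype B j)) (k (g (o j))).
    split; first by apply: kgS; right; exists j.
    rewrite /typeset btype_sockel; exists (k \o g) => //.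
    exact: stabilizer_comp.
  by rewrite -(part_cover P) => -[i _ Pi]; exists i.
exists (fun j => sval (rep j)); split=> //; exists (k \o g).
  exact: stabilizer_comp.
move=> _ [u Au <-]; have := AB _ Au; rewrite btypesetE => -[j _ ju].
exists j => //.
apply: (proj2 (svalP (colour (k (g u))) (Tagged _ (sval (rep j))))).
rewrite -(proj1 (svalP (colour (k (g (o j)))) _) (svalP (rep j))).
apply: (gconst j); first by rewrite mem_enum.
  by exists u => //; split=> //; left.
exists (o j) => //; split; first by right; exists j.
exact: orbit_refl.
Qed.

(** A compactness argument: [finite_selector] picks a selector depending on the finite set, and
    applying it to the union of one missed set per selector makes the choice uniform. *)
Lemma selector_full_age n (B : bundle U n) S (P : colouring M B S) :
  homogeneous M -> free_amalgamation (@age L U M) -> S `<=` btypeset M B ->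
  rho_bar M B S = rho_bar M B (btypeset M B) ->
  exists e : selector P,
    rho_bar M B (selection e) = rho_bar M B (btypeset M B).
Proof.
move=> M_hom M_free SB rhoS; apply: contrapT => /forallNP bad.
(* Finite functions encode the selectors as a finite type, so the union below is finite. *)
pose sel (e : {dffun forall j, 'I_(ncolours P j)}) : selector P := fun j => e j.
have miss e :
    {A | rho_bar M B (btypeset M B) A & ~ rho_bar M B (selection (sel e)) A}.
  apply: cid2; apply: contrapT => none; apply: (bad (sel e)).
  apply/seteqP; split.
    by apply: rho_bar_sub; exact: subset_trans (@selection_sub _ _ _ _ _) SB.
  by move=> A rhoA; apply: contrapT => nA; apply: none; exists A.
pose A := \bigcup_e s2val (miss e).
have [||e [finA AB [g gF gA]]] := finite_selector P M_hom M_free rhoS (A := A).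
- apply: bigcup_finite => [|e _]; first exact: finite_finset.
  by have [] := s2valP (miss e).
- by move=> u [e _]; have [_ AB _] := s2valP (miss e); exact: AB.
have eE : sel (finfun e) = e.
  by apply: functional_extensionality_dep => j; rewrite /sel ffunE.
have [finA' AB' _] := s2valP (miss (finfun e)).
apply: (s2valP' (miss (finfun e))); set A' := s2val _; rewrite eE.
split=> //; exists g => // _ [u Au <-]; apply: gA; exists u => //.
by exists (finfun e).
Qed.

End Homogeneous.

Theorem theorem9p3 (L : language) (U : Type) (M : structure L U)
    (U_countable : countable [set: U])
    (M_homogeneous : homogeneous M)
    (M_free : free_amalgamation (@age L U M))
    (n : nat) (B : bundle U n) :
  [/\ forall S : set U, S `<=` btypeset M B ->
        rho_bar M B S = rho_bar M B (btypeset M B) ->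
        forall (m : nat) (P : colouring M B S), is_mcolouring m P ->
        exists e : selector P,
          rho_bar M B (selection e `&` S) = rho_bar M B (btypeset M B),
      forall S : set U, S `<=` btypeset M B ->
        rho_bar M B S = rho_bar M B (btypeset M B) ->
        age_indivisible_in M B S,
      bundle_age_indivisible M B
    & forall T : vtype U, type_age_indivisible M T].
Proof.
split.
- move=> S SB rhoS m P _.
  have [e eP] := selector_full_age P M_homogeneous M_free SB rhoS.
  by exists e; rewrite setIidl //; exact: selection_sub.
- by move=> S SB rhoS P; rewrite rhoS; exact: selector_full_age.
- by move=> P; exact: selector_full_age.
move=> T S S_disj S_cover.
(* A single type is a bundle with [n = 1], and the partition becomes a colouring with two parts. *)
pose B1 := @Bundle U 1 (sockel T) (fun _ => T) (sockel_finite T)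
  (fun _ => erefl) (fun i j _ => etrans (ord1 i) (esym (ord1 j))).
have B1E : btypeset M B1 = typeset M T.
  by apply/seteqP; split=> [u [_ _ //]|u Tu]; exists ord0.
have part_disj : trivIset setT
    (fun ij : {j : 'I_1 & 'I_((fun=> 2) j)} => S (tagged ij)).
  move=> [j i] [j' i'] _ _ /= SS.
  by rewrite (S_disj _ _ I I SS) (ord1 j) (ord1 j').
have part_cov (j : 'I_1) : \bigcup_i S i = btypeset M B1 `&` typeset M T.
  by rewrite B1E setIid.
pose P := @Colouring L U M 1 B1 (btypeset M B1) (fun=> 2) (fun=> S)
  part_disj part_cov.
have [e eP] :=
  selector_full_age P M_homogeneous M_free (@subset_refl _ _) erefl.
exists (e ord0) => A finA AT.
have : rho_bar M B1 (btypeset M B1) A.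
  split=> //; first by rewrite B1E.
  by exists id; [exact: stabilizer_id|rewrite image_id B1E].
rewrite -eP => -[_ _ [g gF gA]]; exists g => // u /gA[j _].
by rewrite (ord1 j).
Qed.
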